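(* Let $p\in(0,\infty]$, $v\in S^{n-1}$, let $K\subset\mathbb{R}^n$ be a convex body and let $K_t$ be a parallel chord movement of $K$ along the direction $v$, with set of admissible times $T\subset\mathbb{R}$. Then for every $y\in\mathbb{R}^n$ the function $t\mapsto h_{p,K_t}(y)$ is convex on $T$.
   Context: A convex body in $\mathbb{R}^n$ is a compact convex set with non-empty interior; $|\cdot|$ denotes volume, $\langle\cdot,\cdot\rangle$ the standard inner product, $S^{n-1}$ the unit sphere. $L_p$ support function: for $p\in(0,\infty)$ and a convex body $K$, $h_{p,K}(y)=\frac1p\log\Big(\frac{1}{|K|}\int_K e^{p\langle x,y\rangle}dx\Big)$, $y\in\mathbb{R}^n$; for $p=\infty$, $h_{\infty,K}(y)=h_K(y)=\max_{x\in K}\langle x,y\rangle$. Parallel chord movement: for $v\in S^{n-1}$ let $v^\perp=\{x:\langle x,v\rangle=0\}$ and let $K|v^\perp$ be the orthogonal projection of $K$ onto $v^\perp$ (and $x|v^\perp$ that of a point $x$). Given a continuous function $\beta:K|v^\perp\to\mathbb{R}$ (the speed function), put $K_t=\{x+\beta(x|v^\perp)\,t\,v: x\in K\}$. The admissible times are those at which $K_t$ is convex: $T=\{t\in\mathbb{R}:K_t\text{ is convex}\}$ (this set is an interval containing $0$). *)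

(* Defs.v *)
From HB Require Import structures.
From mathcomp Require Import all_boot all_order all_algebra.
From mathcomp Require Import all_classical all_reals all_analysis.

Set Implicit Arguments.
Unset Strict Implicit.
Unset Printing Implicit Defensive.

Import Order.TTheory GRing.Theory Num.Theory.
Import numFieldNormedType.Exports.

Local Open Scope classical_set_scope.
Local Open Scope ring_scope.

(** * Lebesgue measure on ['rV[R]_n]

    ['rV[R]_n] carries the product sigma-algebra, i.e. the one generated by
    the [n] coordinate functions (as for tuples in the library); it is the
    Borel sigma-algebra of the standard topology. *)

Section measurable_rV.
Context {R : realType} (n : nat).

Let coords : 'I_n -> 'rV[R]_n -> R := fun i x => x ord0 i.

Let rV_set0 : g_sigma_preimage coords set0.
Proof. exact: sigma_algebra0. Qed.

Let rV_setC A : g_sigma_preimage coords A -> g_sigma_preimage coords (~` A).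
Proof. exact: sigma_algebraC. Qed.

Let rV_bigcup (F : (set 'rV[R]_n)^nat) :
  (forall i, g_sigma_preimage coords (F i)) ->
  g_sigma_preimage coords (\bigcup_i F i).
Proof. exact: sigma_algebra_bigcup. Qed.

HB.instance Definition _ := @isMeasurable.Build default_measure_display
  'rV[R]_n (g_sigma_preimage coords) rV_set0 rV_setC rV_bigcup.

End measurable_rV.

Lemma measurable_coord (R : realType) n (i : 'I_n) :
  measurable_fun [set: 'rV[R]_n] (fun x => x ord0 i).
Proof.
move=> _ Y mY; rewrite setTI; apply: sub_sigma_algebra => /=.
rewrite -bigcup_seq/=; exists i => /=; first by rewrite mem_index_enum.
by exists Y => //; rewrite setTI.
Qed.

Lemma measurable_fun_rVP d (T : measurableType d) (R : realType) n
    (f : T -> 'rV[R]_n) :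
  measurable_fun [set: T] f <->
  forall i, measurable_fun [set: T] (fun t => f t ord0 i).
Proof.
split=> [mf i|mf].
  by apply: (measurableT_comp (@measurable_coord R n i)).
suff prefS : g_sigma_preimage
    (fun i => (fun x : 'rV[R]_n => x ord0 i : R) \o f) `<=` measurable.
  by move=> _ A mA; apply: prefS; rewrite g_sigma_preimage_comp; exists A.
apply: smallest_sub; first exact: sigma_algebra_measurable.
case: n => [|n] in f mf *; first by rewrite big_ord0.
rewrite -bigcup_mkord_ord; apply: bigcup_sub => i Ii.
by move=> A [B mB <-]; exact: mf.
Qed.

Section lebesgue_rVS.
Context {R : realType} (n : nat).

Definition cons_rV (x : measurableTypeR R * 'rV[R]_n) : 'rV[R]_n.+1 :=
  row_mx (x.1 : R)%:M x.2.

Definition uncons_rV (x : 'rV[R]_n.+1) : measurableTypeR R * 'rV[R]_n :=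
  (x ord0 ord0, \row_i x ord0 (lift ord0 i)).

Lemma cons_rV0 x : cons_rV x ord0 ord0 = x.1.
Proof.
rewrite /cons_rV; have -> : (ord0 : 'I_n.+1) = lshift n (ord0 : 'I_1).
  exact/val_inj.
by apply: etrans (row_mxEl _ _ _ _) _; rewrite mxE eqxx mulr1n.
Qed.

Lemma cons_rVS x (i : 'I_n) : cons_rV x ord0 (lift ord0 i) = x.2 ord0 i.
Proof.
rewrite /cons_rV; have -> : lift ord0 i = rshift 1 i by exact/val_inj.
exact: row_mxEr.
Qed.

Lemma cons_rVK : cancel cons_rV uncons_rV.
Proof.
move=> [a x]; rewrite /uncons_rV cons_rV0; congr pair.
by apply/rowP => i; rewrite mxE cons_rVS.
Qed.

Lemma measurable_cons_rV : measurable_fun [set: _] cons_rV.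
Proof.
apply/measurable_fun_rVP => i; case: (unliftP ord0 i) => [j|] ->.
  under eq_fun do rewrite cons_rVS.
  exact: (measurableT_comp (@measurable_coord R n j)).
by under eq_fun do rewrite cons_rV0; exact: measurable_fst.
Qed.

Lemma measurable_uncons_rV : measurable_fun [set: _] uncons_rV.
Proof.
apply: measurable_fun_pair; first exact: (@measurable_coord R n.+1 ord0).
apply/measurable_fun_rVP => i; under eq_fun do rewrite mxE.
exact: measurable_coord.
Qed.

Variable mu : {sigma_finite_measure set 'rV[R]_n -> \bar R}.

Definition lebesgue_rVS : set 'rV[R]_n.+1 -> \bar R :=
  pushforward (lebesgue_measure \x mu)%E cons_rV.

Let rVS0 : lebesgue_rVS set0 = 0%E.
Proof. by rewrite /lebesgue_rVS /pushforward preimage_set0 measure0. Qed.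

Let rVS_ge0 A : (0 <= lebesgue_rVS A)%E.
Proof. by rewrite /lebesgue_rVS /pushforward; apply: measure_ge0. Qed.

Let rVS_sigma_additive : semi_sigma_additive lebesgue_rVS.
Proof.
have mc B : measurable B -> measurable (cons_rV @^-1` B).
  by move=> mB; rewrite -[X in measurable X]setTI; exact: measurable_cons_rV.
move=> F mF tF mUF; rewrite /lebesgue_rVS /pushforward preimage_bigcup.
apply: measure_semi_sigma_additive.
- by move=> k; exact: mc.
- apply/trivIsetP => /= i j _ _ ij; rewrite -preimage_setI.
  by move/trivIsetP : tF => /(_ _ _ _ _ ij) ->//; rewrite preimage_set0.
- by rewrite -preimage_bigcup; exact: mc.
Qed.

HB.instance Definition _ := isMeasure.Build _ _ _ lebesgue_rVS
  rVS0 rVS_ge0 rVS_sigma_additive.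

Let rVS_sigma_finite : sigma_finite setT lebesgue_rVS.
Proof.
have /sigma_finiteP[F [TF ndF Foo]] := sigma_finiteT (@lebesgue_measure R).
have /sigma_finiteP[G [TG ndG Goo]] := sigma_finiteT mu.
exists (fun k => uncons_rV @^-1` (F k `*` G k)).
  rewrite -preimage_bigcup; apply/seteqP; split => // x _ /=.
  have [i _ Fi] : (\bigcup_i F i) (uncons_rV x).1 by rewrite -TF.
  have [j _ Gj] : (\bigcup_j G j) (uncons_rV x).2 by rewrite -TG.
  exists (maxn i j) => //; split.
    by move: Fi; exact/subsetPset/ndF/leq_maxl.
  by move: Gj; exact/subsetPset/ndG/leq_maxr.
move=> k; have [mF Fk] := Foo k; have [mG Gk] := Goo k; split.
  rewrite -[X in measurable X]setTI; apply: measurable_uncons_rV => //.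
  exact: measurableX.
rewrite /lebesgue_rVS /pushforward -comp_preimage.
rewrite (_ : uncons_rV \o cons_rV = id); last first.
  by apply/funext => x; exact: cons_rVK.
by rewrite preimage_id product_measure1E// lte_mul_pinfty// ge0_fin_numE.
Qed.

HB.instance Definition _ := Measure_isSigmaFinite.Build _ _ _ lebesgue_rVS
  rVS_sigma_finite.

End lebesgue_rVS.

Fixpoint lebesgue_rV (R : realType) (n : nat) :
    {sigma_finite_measure set 'rV[R]_n -> \bar R} :=
  if n is n'.+1 then lebesgue_rVS (lebesgue_rV R n') else dirac (0 : 'rV[R]_0).

Lemma lebesgue_rV_prod (R : realType) n (A : 'I_n -> set R) :
  (forall i, measurable (A i)) ->
  lebesgue_rV R n [set x | forall i, A i (x ord0 i)] =
  (\prod_(i < n) lebesgue_measure (A i))%E.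
Proof.
elim: n A => [|n IHn] A mA.
  rewrite big_ord0 /= diracE mem_set//= => -[].
  by [].
have mB : measurable [set x : 'rV[R]_n | forall i, A (lift ord0 i) (x ord0 i)].
  rewrite [X in measurable X](_ : _ = \bigcap_(i in [set: 'I_n])
      ((fun x : 'rV[R]_n => x ord0 i) @^-1` A (lift ord0 i))); last first.
    by apply/seteqP; split => [x + i _|x + i]; [exact|move/(_ i I)].
  apply: fin_bigcap_measurable => // i _; rewrite -[X in measurable X]setTI.
  by apply: measurable_coord => //; exact: mA.
rewrite big_ord_recl -IHn => [|i]; last exact: mA.
rewrite -product_measure1E//; last exact: mA.
rewrite /= /lebesgue_rVS /pushforward.
congr product_measure1; apply/seteqP; split => [[a x]|[a x]] /=.
  move=> Ax; split => [|i] /=; first by have := Ax ord0; rewrite cons_rV0.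
  by have := Ax (lift ord0 i); rewrite cons_rVS.
move=> [/= Aa Ax] i; case: (unliftP ord0 i) => [j|] ->.
  by rewrite cons_rVS; exact: Ax.
by rewrite cons_rV0.
Qed.

(** * Convex bodies and parallel chord movements *)

Section convex_bodies.
Context {R : realType} {n : nat}.
Implicit Types (x y v : 'rV[R]_n) (K : set 'rV[R]_n) (beta : 'rV[R]_n -> R).

Definition dotr x y : R := \sum_(i < n) x ord0 i * y ord0 i.

(* The library norm on ['rV[R]_n] is the sup norm. *)
Definition enorm x : R := Num.sqrt (dotr x x).

Definition unit_sphere : set 'rV[R]_n := [set v | enorm v = 1].

Definition convex_body K :=
  [/\ compact K, convex_set (K : set (convex_lmodType 'rV[R]_n)) & K° !=set0].

Definition volume K : R := fine (lebesgue_rV R n K).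

(* On compact [K] the integral below is finite, and for nonempty compact [K]
   the [sup] is attained, i.e. is the maximum of [<x, y>] over [K].  Only
   [0 < p] is meaningful; the value at [-oo] is a dummy. *)
Definition Lp_support (p : \bar R) K y : R :=
  match p with
  | q%:E => q^-1 * ln ((volume K)^-1 *
                       \int[lebesgue_rV R n]_(x in K) expR (q * dotr x y))
  | +oo%E => sup [set dotr x y | x in K]
  | -oo%E => 0
  end.

(* The orthogonal projection onto the hyperplane orthogonal to [v], provided
   [v] is a unit vector. *)
Definition proj_perp v x := x - dotr x v *: v.

Definition chord_movement v beta K (t : R) : set 'rV[R]_n :=
  [set x + (beta (proj_perp v x) * t) *: v | x in K].

Definition admissible_times v beta K : set R :=
  [set t | convex_set (chord_movement v beta K t :
                       set (convex_lmodType 'rV[R]_n))].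

End convex_bodies.

(* Main.v *)
(** The movement is [x |-> x + t beta(Px) v], a shear whose amplitude is
    constant along the lines parallel to [v].  It preserves Lebesgue measure, so
    [|K_t| = |K|] and the integral of [exp(p <x, y>)] over [K_t] is the integral
    over [K] of [exp] of a function affine in [t], and such integrals are
    log-convex in [t].  For [p = oo], the support function of [K_t] is a
    supremum over [K] of functions affine in [t]. *)

Require Import Defs.
From mathcomp Require Import all_boot all_order all_algebra.
From mathcomp Require Import all_classical all_reals all_analysis.
From mathcomp Require Import measurable_realfun.
From mathcomp Require Import ring lra.

Import Order.TTheory GRing.Theory Num.Theory.
Import numFieldNormedType.Exports.

Local Open Scope classical_set_scope.
Local Open Scope ring_scope.

(** * Measurability of open sets, compact sets and continuous functions *)

(** An open set is the union of the boxes with rational centre and half-width [1/(k+1)] that it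
    contains. There are countably many, and each is a finite intersection of coordinate
    preimages. *)
Lemma open_rV_measurable (R : realType) (n : nat) (A : set 'rV[R]_n) :
  open A -> measurable A.
Proof.
move=> oA.
pose box (q : 'rV[rat]_n) (k : nat) : set 'rV[R]_n :=
  [set x | forall i, `|x ord0 i - ratr (q ord0 i)| < k.+1%:R^-1].
have mbox q k : measurable (box q k).
  rewrite [X in measurable X](_ : _ = \bigcap_(i in [set: 'I_n])
      ((fun x : 'rV[R]_n => x ord0 i) @^-1`
         (ball (ratr (q ord0 i) : R) k.+1%:R^-1))); last first.
    apply/seteqP; split => x /=.
      by move=> xq i _ /=; rewrite /ball/= distrC; exact: xq.
    by move=> xq i; have := xq i I; rewrite /ball/= distrC.
  apply: fin_bigcap_measurable => // i _; rewrite -[X in measurable X]setTI.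
  apply: measurable_coord => //; apply: open_measurable.
  exact: ball_open.
pose D := [set p : 'rV[rat]_n * nat | box p.1 p.2 `<=` A].
have -> : A = \bigcup_(p in D) box p.1 p.2.
  apply/seteqP; split => [x Ax|x [p Dp] /Dp//].
  have /nbhs_ballP[e /= e0 xeA] := open_nbhs_nbhs (conj oA Ax).
  (* Half of [e]: both [x] and any point of the box lie within [1/(k+1)] of its centre [q], so they
     are less than [e] apart. *)
  have [k ke] : exists k : nat, k.+1%:R^-1 < e / 2.
    have [k _ /(_ k (leqnn k)) h] :=
      near_infty_natSinv_lt (PosNum (divr_gt0 e0 (ltr0Sn R 1))).
    by exists k.
  have [q qP] : exists q : 'rV[rat]_n,
      forall i, `|x ord0 i - ratr (q ord0 i)| < k.+1%:R^-1.
    have h i : exists q : rat, `|x ord0 i - ratr q| < k.+1%:R^-1.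
      have k0 : (0 : R) < k.+1%:R^-1 by rewrite invr_gt0.
      have [q] := @dense_rat R (ball (x ord0 i) k.+1%:R^-1)
        (ex_intro _ _ (ballxx _ k0)) (ball_open _ _).
      by case=> /= h [q' _ e']; exists q'; move: h; rewrite -e'.
    have [f fP] := choice h.
    by exists (\row_i f i) => i; rewrite mxE.
  exists (q, k) => //= z zq; apply: xeA; split => // i j.
  rewrite ord1 /ball /=.
  have := qP j; have := zq j; move: ke.
  rewrite distrC => ke h1 h2.
  rewrite (le_lt_trans (ler_distD (ratr (q ord0 j)) _ _))//.
  rewrite (splitr e) distrC ltrD// distrC; exact: lt_trans ke.
rewrite bigcup_mkcond; apply: countable_bigcupT_measurable => // p.
by case: ifPn.
Qed.

Lemma compact_rV_measurable (R : realType) (n : nat) (A : set 'rV[R]_n) :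
  compact A -> measurable A.
Proof.
move=> /(compact_closed (@norm_hausdorff _ _))/closed_openC.
by move/open_rV_measurable/measurableC; rewrite setCK.
Qed.

Lemma within_continuous_measurable_rV {R : realType} {n : nat}
    (D : set 'rV[R]_n) (f : 'rV[R]_n -> R) :
  measurable D -> {within D, continuous f} -> measurable_fun D f.
Proof.
move=> mD /continuousP cf.
apply: (measurability _ (RGenOpens.measurableE R)) => _ [_ [a [b ->] <-]].
have /open_subspaceP[V oV VD] :
    open (f @^-1` `]a, b[%classic : set (subspace D)).
  exact/cf/interval_open.
by rewrite setIC -VD; apply: measurableI => //; exact: open_rV_measurable.
Qed.

Lemma within_continuous_bounded {R : realType} {n : nat}
    (D : set 'rV[R]_n) (f : 'rV[R]_n -> R) :
  compact D -> {within D, continuous f} ->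
  exists M : R, forall x, D x -> `|f x| <= M.
Proof.
move=> cD cf; have [M [_ /(_ (M + 1)) fM]] :=
  compact_bounded (continuous_compact cf cD).
by exists (M + 1) => x Dx; apply: fM; [rewrite ltrDl|exists x].
Qed.

(** * Translation invariance of Lebesgue measure *)

(** The image of Lebesgue measure under a translation gives half-open intervals their length, hence
    equals Lebesgue measure by uniqueness. *)
Lemma integral_translationR (R : realType) (F : R -> \bar R) (a : R) :
  measurable_fun [set: R] F -> (forall s, 0 <= F s)%E ->
  (\int[@lebesgue_measure R]_s F (s + a)%R = \int[@lebesgue_measure R]_s F s)%E.
Proof.
move=> mF F0.
pose sh : measurableTypeR R -> measurableTypeR R := +%R^~ a.
have msh : measurable_fun setT sh by exact: measurable_funD.
transitivity (\int[pushforward (@lebesgue_measure R) sh]_s F s)%E.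
  by rewrite ge0_integral_pushforward.
apply: eq_measure_integral => A mA _; apply/esym/lebesgue_measure_unique => //.
move=> _ [[b c]] _ <-; rewrite /pushforward.
rewrite [X in _ = lebesgue_measure X](_ : _ = `]b - a, c - a]%classic);
  last first.
  by apply/seteqP; split => x /=; rewrite !in_itv/= ltrBlDr lerBrDr.
rewrite !lebesgue_measure_itv/= !lte_fin ltrD2r.
by case: ifPn => // _; rewrite -!EFinB; congr _%:E; ring.
Qed.

Section lebesgue_rV_integral.
Context {R : realType}.

Lemma integral_lebesgue_rVS (n : nat) (F : 'rV[R]_n.+1 -> \bar R) :
  measurable_fun setT F -> (forall x, 0 <= F x)%E ->
  (\int[lebesgue_rV R n.+1]_x F x =
   \int[@lebesgue_measure R]_a \int[lebesgue_rV R n]_x F (cons_rV (a, x)))%E.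
Proof.
move=> mF F0.
rewrite (ge0_integral_pushforward (@measurable_cons_rV R n)
  (lebesgue_measure \x lebesgue_rV R n)%E)//.
rewrite preimage_setT fubini_tonelli1//.
- by apply: measurableT_comp => //; exact: measurable_cons_rV.
- by move=> p; exact: F0.
Qed.

Lemma measurable_add_rV d (T : measurableType d) (n : nat)
    (f g : T -> 'rV[R]_n) :
  measurable_fun setT f -> measurable_fun setT g ->
  measurable_fun setT (fun t => f t + g t).
Proof.
move=> /measurable_fun_rVP mf /measurable_fun_rVP mg.
apply/measurable_fun_rVP => i; under eq_fun do rewrite mxE.
exact: measurable_funD.
Qed.

Lemma measurable_scale_rV d (T : measurableType d) (n : nat)
    (f : T -> R) (w : 'rV[R]_n) :
  measurable_fun setT f -> measurable_fun setT (fun t => f t *: w).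
Proof.
move=> mf; apply/measurable_fun_rVP => i; under eq_fun do rewrite mxE.
exact: measurable_funM.
Qed.

(** Induction on the dimension: Tonelli splits off the first coordinate, the one-dimensional case
    shifts it, and the induction hypothesis shifts the others. *)
Lemma integral_translation_rV (n : nat) (F : 'rV[R]_n -> \bar R)
    (w : 'rV[R]_n) :
  measurable_fun setT F -> (forall x, 0 <= F x)%E ->
  (\int[lebesgue_rV R n]_x F (x + w)%R = \int[lebesgue_rV R n]_x F x)%E.
Proof.
elim: n F w => [|n IHn] F w mF F0.
  by apply: eq_integral => x _; rewrite [w]thinmx0 addr0.
have mFw : measurable_fun setT (fun x : 'rV[R]_n.+1 => F (x + w)%R).
  by apply: measurableT_comp => //; apply: measurable_add_rV.
rewrite (integral_lebesgue_rVS _ _ mFw (fun x => F0 _)).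
rewrite (integral_lebesgue_rVS _ _ mF F0).
pose w' : 'rV[R]_n := \row_i w ord0 (lift ord0 i).
have mFc : measurable_fun setT
    (fun p : measurableTypeR R * 'rV[R]_n => F (cons_rV p)).
  by apply: measurableT_comp => //; exact: measurable_cons_rV.
pose G (a : R) := (\int[lebesgue_rV R n]_x F (cons_rV (a, x)))%E.
rewrite -[RHS](@integral_translationR _ G (w ord0 ord0)); last 2 first.
- exact: (measurable_fun_fubini_tonelli_F (m2 := lebesgue_rV R n) _ mFc
    (fun p => F0 _)).
- by move=> a; exact: integral_ge0.
apply: eq_integral => a _; rewrite /G.
rewrite -[RHS](IHn (fun x => F (cons_rV (a + w ord0 ord0, x))) w').
- apply: eq_integral => x _; congr F; apply/rowP => i.
  case: (unliftP ord0 i) => [j|] ->.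
    by rewrite mxE !cons_rVS !mxE.
  by rewrite mxE !cons_rV0.
- apply: (measurableT_comp mFc); exact: measurable_pair1.
- by move=> x.
Qed.

End lebesgue_rV_integral.

(** * Invariance of Lebesgue measure under shears *)

Section shear.
Context {R : realType} {n : nat}.
Local Notation lam := (@lebesgue_measure R).
Local Notation mu := (lebesgue_rV R n).

Definition shear (g : 'rV[R]_n -> R) (v x : 'rV[R]_n) : 'rV[R]_n :=
  x + g x *: v.

Lemma measurable_shear (g : 'rV[R]_n -> R) (v : 'rV[R]_n) :
  measurable_fun setT g -> measurable_fun setT (shear g v).
Proof.
by move=> mg; apply: measurable_add_rV => //; exact: measurable_scale_rV.
Qed.

(* Averaging over the translates by [s v], [0 <= s <= 1], and exchanging the
   integrals turns the shear into a translation of [s] by [g x]. *)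
Lemma integral_shear (g : 'rV[R]_n -> R) (v : 'rV[R]_n)
    (F : 'rV[R]_n -> \bar R) :
  measurable_fun setT g -> (forall x s, g (x + s *: v) = g x) ->
  measurable_fun setT F -> (forall x, 0 <= F x)%E ->
  (\int[mu]_x F (shear g v x) = \int[mu]_x F x)%E.
Proof.
move=> mg gv mF F0.
(* [W] is a probability density, so averaging a constant against it changes nothing ([intW]). *)
pose W (s : R) : \bar R := (\1_(`[0, 1]%classic : set R) s)%:E.
have W0 s : (0 <= W s)%E by rewrite lee_fin.
have mW : measurable_fun [set: R] W by exact/measurable_EFinP.
have mFs : measurable_fun setT (fun x => F (shear g v x)).
  by apply: measurableT_comp => //; exact: measurable_shear.
have intW c : (0 <= c -> \int[lam]_s (W s * c) = c)%E.
  move=> c0; rewrite ge0_integralZr//.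
  rewrite integral_indic// setIT -[RHS]mul1e; congr (_ * _)%E.
  have l01 : lebesgue_measure (`[0, 1]%classic : set R) = 1%E.
    by rewrite lebesgue_measure_itv/= lte_fin ltr01 oppr0 adde0.
  exact: l01.
(* [G] averages the translates of the sheared integrand. Substituting [s - g x] for [s] at fixed [x]
   turns [G] into [H]: the shear moves from [F] into the weight. *)
pose G (p : measurableTypeR R * 'rV[R]_n) : \bar R :=
  (W p.1 * F (p.2 + ((p.1 : R) + g p.2)%R *: v)%R)%E.
pose H (p : measurableTypeR R * 'rV[R]_n) : \bar R :=
  (W ((p.1 : R) - g p.2)%R * F (p.2 + (p.1 : R) *: v)%R)%E.
have mfst : measurable_fun [set: measurableTypeR R * 'rV[R]_n]
    (fun p => p.1 : R) by exact: measurable_fst.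
have mg2 : measurable_fun [set: measurableTypeR R * 'rV[R]_n]
    (fun p => g p.2) by exact: measurableT_comp.
have mG : measurable_fun setT G.
  apply: emeasurable_funM; first exact: (measurableT_comp mW).
  apply: measurableT_comp => //; apply: measurable_add_rV => //.
  by apply: measurable_scale_rV; exact: measurable_funD.
have mH : measurable_fun setT H.
  apply: emeasurable_funM.
    by apply: (measurableT_comp mW); exact: measurable_funB.
  apply: measurableT_comp => //; apply: measurable_add_rV => //.
  exact: measurable_scale_rV.
transitivity (\int[lam]_s \int[mu]_x G (s, x))%E.
  rewrite -[LHS](intW (\int[mu]_x F (shear g v x))%E); last exact: integral_ge0.
  apply: eq_integral => s _; rewrite /G/= ge0_integralZl//.
    congr (_ * _)%E.
    rewrite -[LHS](@integral_translation_rV _ _ (fun x => F (shear g v x))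
      ((s : R) *: v))//.
    apply: eq_integral => x _; rewrite /shear gv.
    by rewrite -addrA -scalerDl.
  apply: measurableT_comp => //; apply: measurable_add_rV => //.
  by apply: measurable_scale_rV; exact: measurable_funD.
rewrite (fubini_tonelli G mG); last by move=> p; exact: mule_ge0.
transitivity (\int[mu]_x \int[lam]_s H (s, x))%E.
  apply: eq_integral => x _.
  rewrite -[RHS](@integral_translationR _ (fun s => H (s, x)) (g x));
    last 2 first.
  - exact: (measurableT_comp mH).
  - by move=> s; exact: mule_ge0.
  by apply: eq_integral => s _; rewrite /G /H/= addrK.
rewrite -(fubini_tonelli H mH); last by move=> p; exact: mule_ge0.
(* Translating [x] by [s *: v] at fixed [s] turns [H'] into [H], because [g] is constant along [v].
   In [H'] the factor [F] no longer depends on [s], so the weight integrates out. *)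
pose H' (p : measurableTypeR R * 'rV[R]_n) : \bar R :=
  (W ((p.1 : R) - g p.2)%R * F p.2)%E.
have mH' : measurable_fun setT H'.
  apply: emeasurable_funM.
    by apply: (measurableT_comp mW); exact: measurable_funB.
  exact: measurableT_comp.
transitivity (\int[lam]_s \int[mu]_x H' (s, x))%E.
  apply: eq_integral => s _.
  rewrite -[RHS](@integral_translation_rV _ _ (fun x => H' (s, x))
    ((s : R) *: v)); last 2 first.
  - exact: (measurableT_comp mH').
  - by move=> x; exact: mule_ge0.
  by apply: eq_integral => x _; rewrite /H /H'/= gv.
rewrite (fubini_tonelli H' mH'); last by move=> p; exact: mule_ge0.
apply: eq_integral => x _.
rewrite -[RHS](intW (F x))//.
rewrite -(@integral_translationR _ (fun s => H' (s, x)) (g x)); last 2 first.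
- exact: (measurableT_comp mH').
- by move=> s; exact: mule_ge0.
by apply: eq_integral => s _; rewrite /H'/= addrK.
Qed.

End shear.

(** * Log-convexity of integrals of exponentials *)

(** This is convexity of [expR] at [u - a] and [w - b], multiplied by [expR (l * a + (1 - l) * b)].
    The constants stand in front of [expR u] and [expR w], ready for integration by linearity. *)
Lemma expR_convex_normalized (R : realType) (l : {i01 R}) (u w a b : R) :
  expR (l%:inum * u + (1 - l%:inum) * w) <=
  expR (l%:inum * a + (1 - l%:inum) * b) * (l%:inum * expR (- a)) * expR u +
  expR (l%:inum * a + (1 - l%:inum) * b) * ((1 - l%:inum) * expR (- b)) *
    expR w.
Proof.
have := @convex_expR R l (u - a) (w - b).
rewrite !convRE /unstable.onem; move: (l%:inum) => k.
set c := k * a + (1 - k) * b.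
rewrite -(ler_pM2l (expR_gt0 c)) -expRD.
have -> : c + (k * (u - a) + (1 - k) * (w - b)) = k * u + (1 - k) * w.
  by rewrite /c; ring.
rewrite (expRD u) (expRD w).
suff -> : expR c *
    (k * (expR u * expR (- a)) + (1 - k) * (expR w * expR (- b))) =
    expR c * (k * expR (- a)) * expR u +
    expR c * ((1 - k) * expR (- b)) * expR w by [].
move: (expR c) (expR u) (expR w) (expR (- a)) (expR (- b)) => *; ring.
Qed.

Section ln_Rintegral_expR.
Context d (T : measurableType d) (R : realType).
Variables (mu : {measure set T -> \bar R}) (D : set T).
Hypotheses (mD : measurable D) (muD_gt0 : 0 < fine (mu D)).

Lemma bounded_expR_integrable (u : T -> R) (M : R) :
  measurable_fun D u -> (forall x, D x -> `|u x| <= M) ->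
  mu.-integrable D (EFin \o (fun x => expR (u x))).
Proof.
move=> meas_u uM; apply: measurable_bounded_integrable => //.
(* [fine] sends infinite values to [0], so [muD_gt0] also makes [mu D] finite. *)
- by move: muD_gt0; case: (mu D) => [r _|/=|/=]; rewrite ?ltry ?ltxx.
- exact: measurableT_comp.
- exists (expR M); split; first exact: num_real.
  move=> N MN x Dx; rewrite /= ger0_norm ?expR_ge0// (le_trans _ (ltW MN))//.
  by rewrite ler_expR (le_trans (ler_norm _))// uM.
Qed.

(** The integrand is bounded below on [D] by a positive constant, and [D] has positive mass. *)
Lemma bounded_Rintegral_expR_gt0 (u : T -> R) (M : R) :
  measurable_fun D u -> (forall x, D x -> `|u x| <= M) ->
  0 < \int[mu]_(x in D) expR (u x).
Proof.
move=> meas_u uM; apply: (@lt_le_trans _ _ (\int[mu]_(x in D) expR (- `|M|))).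
  by rewrite Rintegral_cst// mulr_gt0// expR_gt0.
apply: le_Rintegral => //.
- apply: (@bounded_expR_integrable _ `|M|) => // x _.
  by rewrite normrN normr_id.
- exact: bounded_expR_integrable uM.
- move=> x Dx; rewrite ler_expR lerNl (le_trans (ler_norm _))// normrN.
  by rewrite (le_trans (uM x Dx))// ler_norm.
Qed.

(* After subtracting the logarithms of both integrals, which normalizes them
   to 1, the inequality follows by integrating the pointwise convexity of
   [expR]. *)
Lemma ln_Rintegral_expR_convex (u w : T -> R) (M : R) (l : {i01 R}) :
  measurable_fun D u -> measurable_fun D w ->
  (forall x, D x -> `|u x| <= M) -> (forall x, D x -> `|w x| <= M) ->
  ln (\int[mu]_(x in D) expR (l%:inum * u x + (1 - l%:inum) * w x)) <=
  l%:inum * ln (\int[mu]_(x in D) expR (u x)) +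
  (1 - l%:inum) * ln (\int[mu]_(x in D) expR (w x)).
Proof.
move=> meas_u meas_w uM wM.
have Iu := bounded_Rintegral_expR_gt0 u M meas_u uM.
have Iw := bounded_Rintegral_expR_gt0 w M meas_w wM.
pose A := ln (\int[mu]_(x in D) expR (u x)).
pose B := ln (\int[mu]_(x in D) expR (w x)).
pose z x := l%:inum * u x + (1 - l%:inum) * w x.
have mz : measurable_fun D z by apply: measurable_funD; exact: measurable_funM.
have l0 : 0 <= l%:inum by [].
have l1 : 0 <= 1 - l%:inum by rewrite subr_ge0.
have zM x : D x -> `|z x| <= M.
  move=> Dx; rewrite (le_trans (ler_normD _ _))// !normrM.
  rewrite (ger0_norm l0) (ger0_norm l1).
  have -> : M = l%:inum * M + (1 - l%:inum) * M.
    by rewrite -mulrDl addrC subrK mul1r.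
  by rewrite lerD// ler_wpM2l// ?uM ?wM.
have Iz := bounded_Rintegral_expR_gt0 z M mz zM.
(* [C] is the target bound; since [ln (expR C) = C], it suffices to bound the integral by
   [expR C]. *)
pose C := l%:inum * A + (1 - l%:inum) * B.
rewrite -[leRHS](expRK C) ler_ln ?posrE ?expR_gt0//.
have ineq x := expR_convex_normalized R l (u x) (w x) A B.
have iu := bounded_expR_integrable u M meas_u uM.
have iw := bounded_expR_integrable w M meas_w wM.
have iz := bounded_expR_integrable z M mz zM.
pose cu := expR C * (l%:inum * expR (- A)).
pose cw := expR C * ((1 - l%:inum) * expR (- B)).
have icu : mu.-integrable D (EFin \o (fun x => cu * expR (u x))).
  exact: (integrableZl mD cu iu).
have icw : mu.-integrable D (EFin \o (fun x => cw * expR (w x))).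
  exact: (integrableZl mD cw iw).
apply: (@le_trans _ _ (\int[mu]_(x in D) (cu * expR (u x) + cw * expR (w x)))).
  by apply: le_Rintegral => //; exact: (integrableD mD icu icw).
rewrite RintegralD// !RintegralZl//.
(* [expR (- A)] and [expR (- B)] are the inverses of the two integrals, so the integrated bound is
   [expR C] times [l + (1 - l) = 1]. *)
have normalize (c k a i b j : R) : a * i = 1 -> b * j = 1 ->
    c * (k * a) * i + c * ((1 - k) * b) * j = c.
  by move=> ai bj; rewrite -!mulrA ai bj; ring.
have expNln (r : R) : 0 < r -> expR (- ln r) * r = 1.
  by move=> r0; rewrite expRN lnK ?posrE// mulVf// gt_eqF.
rewrite le_eqVlt; apply/orP; left; apply/eqP.
exact: normalize _ _ _ _ _ _ (expNln _ Iu) (expNln _ Iw).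
Qed.

End ln_Rintegral_expR.

(** * The inner product and the projection along [v] *)

Section dotr_proj.
Context {R : realType} {n : nat}.
Implicit Types x y v : 'rV[R]_n.

Lemma dotrDl x x' y : dotr (x + x') y = dotr x y + dotr x' y.
Proof.
by rewrite /dotr -big_split; apply: eq_bigr => i _; rewrite mxE mulrDl.
Qed.

Lemma dotrZl (a : R) x y : dotr (a *: x) y = a * dotr x y.
Proof.
by rewrite /dotr mulr_sumr; apply: eq_bigr => i _; rewrite mxE mulrA.
Qed.

Lemma dotr_unit_sphere v : unit_sphere v -> dotr v v = 1.
Proof.
move=> /= v1; rewrite -[LHS]sqr_sqrtr; last first.
  by apply: sumr_ge0 => i _; rewrite -expr2 sqr_ge0.
by rewrite -/(enorm v) v1 expr1n.
Qed.

(** Makes any function of the projection constant along lines parallel to [v], as [integral_shear]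
    requires. *)
Lemma proj_perp_shift v x (s : R) :
  unit_sphere v -> proj_perp v (x + s *: v) = proj_perp v x.
Proof.
move=> /dotr_unit_sphere v1; rewrite /proj_perp dotrDl dotrZl v1 mulr1 scalerDl.
by rewrite opprD addrACA subrr addr0.
Qed.

Lemma continuous_dotr y : continuous (fun x => dotr x y).
Proof.
rewrite /dotr; apply: continuous_big => [|i _ x]; first exact: add_continuous.
by apply: continuousM; [exact: coord_continuous|exact: cst_continuous].
Qed.

Lemma continuous_proj_perp v : continuous (proj_perp v).
Proof.
move=> x; rewrite /proj_perp.
apply: (@continuousB _ _ _ id (fun x => dotr x v *: v)); first exact: cvg_id.
by apply: continuousZr_tmp; exact: continuous_dotr.
Qed.

Lemma measurable_dotr y : measurable_fun setT (fun x => dotr x y).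
Proof.
apply: measurable_sum => i; apply: measurable_funM => //.
exact: measurable_coord.
Qed.

Lemma measurable_proj_perp v : measurable_fun setT (proj_perp v).
Proof.
rewrite /proj_perp; under eq_fun do rewrite -scaleNr.
apply: measurable_add_rV => //; apply: measurable_scale_rV.
by apply: measurableT_comp => //; exact: measurable_dotr.
Qed.

End dotr_proj.

(** * Chord movements as measure-preserving shears *)

Section chord_movement.
Context {R : realType} {n : nat}.
Variables (v : 'rV[R]_n) (K : set 'rV[R]_n) (beta : 'rV[R]_n -> R).
Hypotheses (v_unit : unit_sphere v) (K_compact : compact K).
Hypothesis beta_cont : {within proj_perp v @` K, continuous beta}.

Let PK_compact : compact (proj_perp v @` K).
Proof.
apply: continuous_compact K_compact.
exact: continuous_subspaceT (continuous_proj_perp v).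
Qed.

Let K_measurable : measurable K.
Proof. exact: compact_rV_measurable K_compact. Qed.

(** Continuity of [beta] is known only on the projection of [K]; extending by a constant off that
    set gives a speed measurable on the whole space. *)
Let speed (x : 'rV[R]_n) : R := (beta \_ (proj_perp v @` K)) (proj_perp v x).

Let speedE x : K x -> speed x = beta (proj_perp v x).
Proof. by move=> Kx; rewrite /speed patchE mem_set//; exists x. Qed.

Let speed_shift x s : speed (x + s *: v) = speed x.
Proof. by rewrite /speed proj_perp_shift. Qed.

Let measurable_speed : measurable_fun setT speed.
Proof.
apply: measurableT_comp; last exact: measurable_proj_perp.
have mPK : measurable (proj_perp v @` K).
  exact: compact_rV_measurable PK_compact.
apply/(measurable_restrictT beta mPK).
by apply: within_continuous_measurable_rV.
Qed.

Let flow (t : R) := shear (fun x => speed x * t) v.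

Let measurable_flow t : measurable_fun setT (flow t).
Proof. by apply: measurable_shear; exact: measurable_funM. Qed.

(** The flow moves points along [v], where [speed] is constant, so reversing time undoes it. *)
Let flowK t : cancel (flow t) (flow (- t)).
Proof. by move=> x; rewrite /flow /shear speed_shift mulrN scaleNr addrK. Qed.

(** Writing the image of [K] as a preimage under the reverse flow yields its measurability. *)
Let chord_movementE t : chord_movement v beta K t = flow (- t) @^-1` K.
Proof.
apply/seteqP; split => [_ [x Kx <-] /=|x Kx /=].
  by rewrite -speedE// -/(flow t x) flowK.
exists (flow (- t) x) => //.
by rewrite -speedE// -{3}(flowK (- t) x) opprK.
Qed.

Lemma measurable_chord_movement t : measurable (chord_movement v beta K t).
Proof.
by rewrite chord_movementE -[X in measurable X]setTI; exact: measurable_flow.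
Qed.

Lemma integral_chord_movement t (f : 'rV[R]_n -> \bar R) :
  measurable_fun setT f -> (forall x, 0 <= f x)%E ->
  (\int[lebesgue_rV R n]_(x in chord_movement v beta K t) f x =
   \int[lebesgue_rV R n]_(x in K) f (x + (beta (proj_perp v x) * t) *: v)%R)%E.
Proof.
move=> mf f0; rewrite integral_mkcond [RHS]integral_mkcond.
rewrite -(integral_shear (fun x => speed x * t) v).
- apply: eq_integral => x _; rewrite -/(flow t x) !patchE chord_movementE.
  (* The shear carries the indicator of [K_t] to that of [K]. *)
  have -> : (flow t x \in flow (- t) @^-1` K) = (x \in K).
    apply/idP/idP => [/set_mem /=|/set_mem Kx].
      by rewrite flowK => /mem_set.
    by apply/mem_set; rewrite /= flowK.
  by case: ifPn => // /set_mem Kx; rewrite /flow /shear speedE.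
- exact: measurable_funM.
- by move=> x s; rewrite speed_shift.
- apply/(measurable_restrictT f (measurable_chord_movement t)).
  exact: measurable_funTS.
- by move=> x; rewrite patchE; case: ifP.
Qed.

Lemma volume_chord_movement t : volume (chord_movement v beta K t) = volume K.
Proof.
rewrite /volume; congr fine.
have := integral_chord_movement t (cst 1%E).
rewrite !integral_cst ?mul1e//; first by apply.
exact: measurable_chord_movement.
Qed.

Lemma Rintegral_chord_movement t (f : 'rV[R]_n -> R) :
  measurable_fun setT f -> (forall x, 0 <= f x) ->
  \int[lebesgue_rV R n]_(x in chord_movement v beta K t) f x =
  \int[lebesgue_rV R n]_(x in K) f (x + (beta (proj_perp v x) * t) *: v).
Proof.
move=> mf f0; congr fine; apply: (integral_chord_movement t (EFin \o f)).
- exact/measurable_EFinP.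
- by move=> x; rewrite lee_fin.
Qed.

Lemma measurable_dotr_chord_movement y t : measurable_fun K
  (fun x => dotr (x + (beta (proj_perp v x) * t) *: v) y).
Proof.
apply: (@eq_measurable_fun _ _ _ _ K (fun x => dotr (flow t x) y)).
  by move=> x /set_mem Kx; rewrite /flow /shear speedE.
apply: measurable_funTS; apply: (measurableT_comp (measurable_dotr y)).
exact: measurable_flow.
Qed.

(** Compactness bounds [dotr x y] on [K] and [beta] on the projection of [K]. The bound serves both
    the finiteness of suprema and the integrability of exponentials. *)
Lemma chord_movement_bounded y t : exists M : R, forall x, K x ->
  `|dotr (x + (beta (proj_perp v x) * t) *: v) y| <= M.
Proof.
have [M1 K1] := within_continuous_bounded K _ K_compact
  (continuous_subspaceT (continuous_dotr y)).
have [M2 K2] := within_continuous_bounded _ _ PK_compact beta_cont.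
exists (M1 + M2 * `|t| * `|dotr v y|) => x Kx.
rewrite dotrDl dotrZl (le_trans (ler_normD _ _))// lerD ?K1// !normrM.
by rewrite !ler_wpM2r// K2//; exists x.
Qed.

End chord_movement.

(* At [V = 0], the junk values [0^-1 = 0] and [ln 0 = 0] make both sides [0]. *)
Lemma ln_normalized_convex (R : realType) (q V l i j k : R) :
  0 < q -> 0 <= V ->
  (0 < V -> [/\ 0 < i, 0 < j, 0 < k & ln i <= l * ln j + (1 - l) * ln k]) ->
  q^-1 * ln (V^-1 * i) <=
  l * (q^-1 * ln (V^-1 * j)) + (1 - l) * (q^-1 * ln (V^-1 * k)).
Proof.
move=> q0; rewrite le_eqVlt => /orP[/eqP <- _|V0 /(_ V0)[i0 j0 k0 ijk]].
  by rewrite invr0 !mul0r ln0// !mulr0 addr0.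
have iV0 : 0 < V^-1 by rewrite invr_gt0.
(* The terms [ln V^-1] have total weight [1] on both sides and cancel. *)
rewrite !lnM ?posrE// (mulrCA l) (mulrCA (1 - l)) -mulrDr ler_pM2l ?invr_gt0//.
move: ijk; lra.
Qed.

(** * Convexity in time of the support functions, for infinite and finite [p] *)

Theorem theorem1p1 (R : realType) (n : nat) (p : \bar R) (v : 'rV[R]_n)
    (K : set 'rV[R]_n) (beta : 'rV[R]_n -> R)
    (p_gt0 : (0 < p)%E)
    (v_unit : unit_sphere v)
    (K_body : convex_body K)
    (beta_cont : {within proj_perp v @` K, continuous beta})
    (y : 'rV[R]_n) :
  convex_function (admissible_times v beta K : set (convex_lmodType R^o))
    (fun t : R => Lp_support p (chord_movement v beta K t) y).
Proof.
case: K_body => K_compact _ _ l s t _ _.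
(* For each fixed point [x], the inner product of its moved position with [y] is affine in time. *)
have Phi_conv x : dotr (x + (beta (proj_perp v x) * (conv l s t : R)) *: v) y =
    l%:inum * dotr (x + (beta (proj_perp v x) * s) *: v) y +
    (1 - l%:inum) * dotr (x + (beta (proj_perp v x) * t) *: v) y.
  rewrite (_ : (conv l s t : R) = l%:inum * s + (1 - l%:inum) * t)//.
  by rewrite !dotrDl !dotrZl; ring.
have l0 : 0 <= l%:inum by [].
have l1 : 0 <= 1 - l%:inum by rewrite subr_ge0.
case: p p_gt0 => [q||//] p_gt0; rewrite convRE /unstable.onem /=; last first.
  (* [sup set0] is [0], so both sides vanish for empty [K]; otherwise [x0] supplies the nonemptiness
     that [ge_sup] asks for. *)
  have [K0|/set0P[x0 Kx0]] := eqVneq K set0.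
    by rewrite /chord_movement K0 !image_set0 sup0 !mulr0 addr0.
  apply: ge_sup.
    by exists (dotr (x0 + (beta (proj_perp v x0) * (conv l s t : R)) *: v) y),
      (x0 + (beta (proj_perp v x0) * (conv l s t : R)) *: v) => //; exists x0.
  move=> _ [_ [x Kx <-] <-]; rewrite Phi_conv.
  have sup_ub r : dotr (x + (beta (proj_perp v x) * r) *: v) y <=
      sup [set dotr z y | z in chord_movement v beta K r].
    have [M rM] := chord_movement_bounded v K beta K_compact beta_cont y r.
    apply: ub_le_sup; last by eexists; [exists x|].
    by exists M => _ [_ [z Kz <-] <-]; rewrite (le_trans (ler_norm _))// rM.
  by rewrite lerD// ler_wpM2l.
have q0 : 0 < q by rewrite -lte_fin.
have mE : measurable_fun setT (fun x : 'rV[R]_n => expR (q * dotr x y)).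
  apply: measurableT_comp => //; apply: measurable_funM => //.
  exact: measurable_dotr.
(* All volumes become that of [K] and all integrals run over [K], so time survives only in the
   exponent. *)
rewrite !volume_chord_movement// !Rintegral_chord_movement//;
  try by move=> x; exact: expR_ge0.
apply: ln_normalized_convex => [//||V0]; first exact: fine_ge0.
pose U r x := q * dotr (x + (beta (proj_perp v x) * r) *: v) y.
have mK : measurable K := compact_rV_measurable R n K K_compact.
have mU r : measurable_fun K (U r).
  apply: measurable_funM => //.
  exact: measurable_dotr_chord_movement v K beta K_compact beta_cont y r.
have U_bounded r : exists M, forall x, K x -> `|U r x| <= M.
  have [M rM] := chord_movement_bounded v K beta K_compact beta_cont y r.
  by exists (q * M) => x Kx; rewrite normrM (gtr0_norm q0) ler_pM2l// rM.
have U_gt0 r : 0 < \int[lebesgue_rV R n]_(x in K) expR (U r x).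
  have [M rM] := U_bounded r.
  exact: bounded_Rintegral_expR_gt0 mK V0 (U r) M (mU r) rM.
split; [exact: U_gt0|exact: U_gt0|exact: U_gt0|].
have [M1 sM] := U_bounded s; have [M2 tM] := U_bounded t.
(* The log-convexity lemma takes one bound for both exponents, hence the maximum. *)
have sM' x : K x -> `|U s x| <= Num.max M1 M2.
  by move=> Kx; rewrite le_max sM.
have tM' x : K x -> `|U t x| <= Num.max M1 M2.
  by move=> Kx; rewrite le_max tM// orbT.
have Ust : \int[lebesgue_rV R n]_(x in K) expR (U (conv l s t) x) =
    \int[lebesgue_rV R n]_(x in K)
      expR (l%:inum * U s x + (1 - l%:inum) * U t x).
  by apply: eq_Rintegral => x _; rewrite /U Phi_conv; congr expR; ring.
have := ln_Rintegral_expR_convex _ _ _ (lebesgue_rV R n) K mK V0 _ _ _ l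
  (mU s) (mU t) sM' tM'.
by rewrite -Ust.
Qed.
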